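(* Let $(\mathbb T,d)$ be a locally compact, separable metric space. Let $K\subset\mathbb T$ be compact and let $f\in\ell^\infty_{\mathrm{loc}}(\mathbb T)$ be continuous at every $x\in K$. If $f_n$ hypi-converges to $f$ in $\ell^\infty_{\mathrm{loc}}(\mathbb T)$, then $\sup_{x\in K}|f_n(x)-f(x)|\to0$ as $n\to\infty$.
   Context: $\ell^\infty_{\mathrm{loc}}(\mathbb T)$ is the set of functions $f:\mathbb T\to\mathbb R$ that are bounded on compact subsets of $\mathbb T$. For such $f$, $f_\wedge(x)=\sup_{\varepsilon>0}\inf\{f(x'):d(x',x)<\varepsilon\}$ and $f_\vee(x)=\inf_{\varepsilon>0}\sup\{f(x'):d(x',x)<\varepsilon\}$. A sequence $f_n\in\ell^\infty_{\mathrm{loc}}(\mathbb T)$ hypi-converges to $f\in\ell^\infty_{\mathrm{loc}}(\mathbb T)$ if $f_n$ epi-converges to $f_\wedge$ and hypo-converges to $f_\vee$, i.e. if for every $x\in\mathbb T$: (a) for all sequences $x_n\to x$, $f_\wedge(x)\le\liminf_nf_n(x_n)$ and $\limsup_nf_n(x_n)\le f_\vee(x)$; (b) there exists a sequence $x_n\to x$ with $\limsup_nf_n(x_n)\le f_\wedge(x)$; (c) there exists a sequence $x_n\to x$ with $\liminf_nf_n(x_n)\ge f_\vee(x)$. ''Continuous at $x\in K$'' refers to continuity of $f$ as a function on $\mathbb T$. *)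

(* Defs.v *)
From mathcomp Require Import all_boot all_order all_algebra.
From mathcomp Require Import all_classical all_reals all_analysis.

Set Implicit Arguments.
Unset Strict Implicit.
Unset Printing Implicit Defensive.

Import Order.TTheory GRing.Theory Num.Theory.
Import numFieldNormedType.Exports.

Local Open Scope classical_set_scope.
Local Open Scope ring_scope.
Local Open Scope ereal_scope.

Definition separable_space (T : topologicalType) : Prop :=
  exists2 D : set T, countable D & dense D.

Definition linfty_loc (R : realType) (T : metricType R) : set (T -> R) :=
  [set f | forall C : set T, compact C -> [bounded f x | x in C]].

(* The hulls take values in the extended reals: an f in linfty_loc may be
   unbounded on large balls, where the infimum (supremum) is infinite. *)
Definition lower_hull (R : realType) (T : metricType R) (f : T -> R) (x : T) :
    \bar R :=
  ereal_sup [set ereal_inf [set (f y)%:E | y in ball x e] | e in [set e : R | (0 < e)%R]].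

Definition upper_hull (R : realType) (T : metricType R) (f : T -> R) (x : T) :
    \bar R :=
  ereal_inf [set ereal_sup [set (f y)%:E | y in ball x e] | e in [set e : R | (0 < e)%R]].

Definition epi_converges (R : realType) (T : metricType R)
    (f_ : nat -> T -> R) (g : T -> \bar R) : Prop :=
  forall x : T,
    (forall x_ : nat -> T, x_ @ \oo --> x ->
       g x <= limn_einf (fun n => (f_ n (x_ n))%:E)) /\
    (exists2 x_ : nat -> T, x_ @ \oo --> x &
       limn_esup (fun n => (f_ n (x_ n))%:E) <= g x).

Definition hypo_converges (R : realType) (T : metricType R)
    (f_ : nat -> T -> R) (g : T -> \bar R) : Prop :=
  forall x : T,
    (forall x_ : nat -> T, x_ @ \oo --> x ->
       limn_esup (fun n => (f_ n (x_ n))%:E) <= g x) /\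
    (exists2 x_ : nat -> T, x_ @ \oo --> x &
       g x <= limn_einf (fun n => (f_ n (x_ n))%:E)).

Definition hypi_converges (R : realType) (T : metricType R)
    (f_ : nat -> T -> R) (f : T -> R) : Prop :=
  epi_converges f_ (lower_hull f) /\ hypo_converges f_ (upper_hull f).

(* This real-valued sup is 0 when K is empty or the difference is unbounded
   on K; the latter cannot occur for f, g in linfty_loc and K compact. *)
Definition sup_dist (R : realType) (T : Type) (K : set T) (f g : T -> R) : R :=
  sup [set `|f x - g x|%R | x in K].

(* Main.v *)
(* At a point x where f is continuous both hulls equal f x, so f_n (x_n) -> f x
   along every sequence x_n -> x. This sequential statement upgrades to
   f_n y -> f x as (y, n) -> (x, oo), and compactness of K makes it uniform. *)

Require Import Defs.
From mathcomp Require Import all_boot all_order all_algebra.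
From mathcomp Require Import all_classical all_reals all_analysis.

Import Order.TTheory GRing.Theory Num.Theory.
Import numFieldNormedType.Exports.

Local Open Scope classical_set_scope.
Local Open Scope ring_scope.

(** [limn_esup u] is the infimum, over sets [V] in the filter [\oo], of the supremum of [u] on [V],
    so a strict upper bound already holds on one such [V]. *)
Lemma limn_esup_lt_near (R : realType) (u : (\bar R)^nat) (a : \bar R) :
  (limn_esup u < a)%E -> \forall n \near \oo, (u n < a)%E.
Proof.
move=> /ereal_inf_lt[_ [V Voo <-] supV].
apply: filterS Voo => n Vn; apply: le_lt_trans supV.
by apply: ereal_sup_ubound; exists n.
Qed.

Lemma limn_einf_gt_near (R : realType) (u : (\bar R)^nat) (a : \bar R) :
  (a < limn_einf u)%E -> \forall n \near \oo, (a < u n)%E.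
Proof.
rewrite -lteN2 -limn_esupN => /limn_esup_lt_near.
by apply: filterS => n /=; rewrite lteN2.
Qed.

(** This is the half that rests on continuity: the reverse inequality holds for every [f], as each
    ball contains its centre. *)
Lemma upper_hull_continuous (R : realType) (T : metricType R) (f : T -> R)
    (x : T) : {for x, continuous f} -> (upper_hull f x <= (f x)%:E)%E.
Proof.
move=> /cvgr_dist_le fx; apply/lee_addgt0Pr => e e0.
have /nbhs_ballP[d /= d0 xd] := fx e e0.
apply: le_trans (ereal_inf_lbound _) _; first by exists d.
apply: ge_ereal_sup => _ [y /xd /= fxy <-].
by rewrite -EFinD lee_fin -lerBlDl (le_trans (ler_norm _)) // distrC.
Qed.

Lemma lower_hull_continuous (R : realType) (T : metricType R) (f : T -> R)
    (x : T) : {for x, continuous f} -> ((f x)%:E <= lower_hull f x)%E.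
Proof.
move=> /cvgr_dist_le fx; apply/lee_addgt0Pr => e e0.
have /nbhs_ballP[d /= d0 xd] := fx e e0.
rewrite -leeBlDr //.
apply: le_trans (ereal_sup_ubound _); last by exists d.
apply: le_ereal_inf_tmp => _ [y /xd /= fxy <-].
by rewrite -EFinB lee_fin lerBlDl -lerBlDr (le_trans (ler_norm _)).
Qed.

(* A counterexample to the right-hand side consists of pairs (n_k, y_k) with
   n_k >= k and y_k -> x. Setting x_n := y_k for some k with n_k = n (and
   x_n := x if there is none) gives a full sequence x_n -> x, because n_k = n
   forces k -> oo as n -> oo: k < j holds for finitely many n_k only. *)
Lemma near_pair_sequential (R : realType) (T : metricType R)
    (P : nat -> T -> Prop) (x : T) :
  (forall x_ : nat -> T, x_ @ \oo --> x -> \forall n \near \oo, P n (x_ n)) ->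
  \forall y \near x & n \near \oo, P n y.
Proof.
move=> Pseq; apply: contrapT => NP.
have /choice[w wP] : forall k : nat, exists ny : nat * T,
    [/\ (k <= ny.1)%N, ball x (k.+1%:R^-1 : R) ny.2 & ~ P ny.1 ny.2].
  move=> k; apply: contrapT => Nk; apply: NP.
  exists (ball x (k.+1%:R^-1 : R), [set n | (k <= n)%N]) => /=.
    split; last exact: nbhs_infty_ge.
    by apply: nbhsx_ballx; rewrite invr_gt0 ltr0n.
  move=> [y n] /= [xy kn]; apply: contrapT => NPny; apply: Nk.
  by exists (n, y).
have /choice[x_ x_P] : forall n : nat, exists y : T,
    (exists2 k, (w k).1 = n & y = (w k).2) \/
    ((forall k, (w k).1 <> n) /\ y = x).
  move=> n; have [[k kn]|Nn] := pselect (exists k, (w k).1 = n).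
    by exists (w k).2; left; exists k.
  by exists x; right; split=> // k kn; apply: Nn; exists k.
have x_x : x_ @ \oo --> x.
  apply/cvg_ballP => e e0; have [j _ je] := near_infty_natSinv_lt (PosNum e0).
  (* The sum bounds every [(w k).1] with [k < j], so an index [n] beyond it can only come from some
     [k >= j]. *)
  exists (\sum_(k < j) (w k).1).+1 => // n /= jn.
  have [[k kn ->]|[_ ->]] := x_P n; last exact: ballxx.
  have [_ xwk _] := wP k; apply: le_ball xwk; apply: ltW; apply: je => /=.
  rewrite leqNgt; apply/negP => kj; move: jn.
  by rewrite -kn (bigD1 (Ordinal kj)) //= ltnNge leq_addr.
(* At the index [(w N).1 >= N] the sequence takes a value [(w k).2] with [(w k).1 = (w N).1], where
   [k] may differ from [N]; [P] fails there all the same. *)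
have [N _ PN] := Pseq _ x_x.
have [Nw _ _] := wP N.
have := PN _ Nw.
have [[k kn ->]|[/(_ N)]//] := x_P (w N).1.
by rewrite -kn; have [_ _] := wP k.
Qed.

Lemma hypi_converges_continuous_near (R : realType) (T : metricType R)
    (f_ : nat -> T -> R) (f : T -> R) (x : T) (e : R) :
  hypi_converges f_ f -> {for x, continuous f} -> 0 < e ->
  \forall y \near x & n \near \oo, `|f_ n y - f x| < e.
Proof.
move=> [epi hypo] fx e0.
apply: (@near_pair_sequential R T (fun n y => `|f_ n y - f x| < e)) => x_ x_x.
have lt_esup : (limn_esup (fun n => (f_ n (x_ n))%:E) < (f x + e)%:E)%E.
  apply: le_lt_trans ((hypo x).1 _ x_x) _.
  by apply: le_lt_trans (upper_hull_continuous _ _ _ _ fx) _; rewrite lte_fin ltrDl.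
have gt_einf : ((f x - e)%:E < limn_einf (fun n => (f_ n (x_ n))%:E))%E.
  apply: lt_le_trans ((epi x).1 _ x_x).
  by apply: lt_le_trans (lower_hull_continuous _ _ _ _ fx); rewrite lte_fin gtrBl.
apply: filterS2 (limn_esup_lt_near _ _ _ lt_esup) (limn_einf_gt_near _ _ _ gt_einf).
by move=> n; rewrite !lte_fin ltr_distl => -> ->.
Qed.

Theorem proposition2p2 (R : realType) (T : metricType R)
    (hlc : locally_compact [set: T]) (hsep : separable_space T)
    (K : set T) (hK : compact K)
    (f : T -> R) (hf : linfty_loc f)
    (hcont : forall x : T, K x -> {for x, continuous f})
    (f_ : nat -> T -> R) (hf_ : forall n : nat, linfty_loc (f_ n))
    (hconv : hypi_converges f_ f) :
  sup_dist K (f_ n) f @[n --> \oo] --> (0 : R).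
Proof.
apply/cvgr0Pnorm_le => e e0.
have e20 : 0 < e / 2 by rewrite divr_gt0.
(* The near-covering form of compactness, with [n] near [\oo] as parameter, replaces the choice of a
   finite subcover and of the largest of its thresholds. *)
have /compact_near_coveringP/(_ nat \oo
    (fun n y => `|f_ n y - f y| < e) _) cover := hK.
have {cover} : \forall n \near \oo, K `<=` (fun y => `|f_ n y - f y| < e).
  apply: cover => x Kx.
  have fnear : \forall y \near x & n \near \oo, `|f x - f y| < e / 2.
    have /cvgr_dist_lt/(_ _ e20) fx := hcont x Kx.
    by exists ([set y | `|f x - f y| < e / 2], setT) => [|[y n] []//]; split=> //; exact: filterT.
  apply: filterS2 fnear (hypi_converges_continuous_near _ _ _ _ _ _ hconv (hcont x Kx) e20).
  move=> [y n] /= fxy fnx.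
  by rewrite (splitr e) (le_lt_trans (ler_distD (f x) _ _)) // ltrD.
apply: filterS => n fnK; rewrite /sup_dist.
(* For empty [K] the supremum is 0 by convention; otherwise a point of [K] makes the set of values
   nonempty and its supremum nonnegative. *)
have [->|/set0P[x Kx]] := eqVneq K set0.
  by rewrite image_set0 sup0 normr0 ltW.
have ubK : ubound [set `|f_ n y - f y| | y in K] e.
  by move=> _ [y /fnK /ltW fny <-].
rewrite ger0_norm; first by apply: ge_sup => //; exists `|f_ n x - f x|, x.
apply: le_trans (ub_le_sup _ _); last by exists x.
  exact: normr_ge0.
by exists e.
Qed.
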